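(* $\mathsf{TS4}$ is canonical; that is, if $\mathfrak B$ is a $\mathsf{TS4}$-algebra, then $(\mathfrak B_+)^+$ is a $\mathsf{TS4}$-algebra.
   Context: An interior operator on a boolean algebra $B$ is a map $\mathsf i:B\to B$ with $\mathsf i(a\wedge b)=\mathsf ia\wedge\mathsf ib$, $\mathsf i1=1$, $\mathsf ia\le a$, $\mathsf ia\le\mathsf{ii}a$. A $\mathsf{TS4}$-algebra is a tuple $\mathfrak B=(B,\Box,\blacksquare_F,\blacksquare_P)$ where $B$ is a boolean algebra, $\Box,\blacksquare_F,\blacksquare_P$ are interior operators on $B$, and, writing $\Diamond=\neg\Box\neg$, for all $a\in B$: $a\le\blacksquare_P\neg\blacksquare_F\neg a$, $a\le\blacksquare_F\neg\blacksquare_P\neg a$, $\Diamond a\le\neg\blacksquare_F\neg a$, and $\neg\blacksquare_F\neg a\le\Diamond(\neg\blacksquare_F\neg a\wedge\neg\blacksquare_P\neg a)$. The canonical frame of $\mathfrak B$ is $\mathfrak B_+=(X_{\mathfrak B},R_{\mathfrak B},Q_{\mathfrak B})$, where $X_{\mathfrak B}$ is the set of ultrafilters of $B$; $xR_{\mathfrak B}y$ iff $x\cap H\subseteq y$, with $H=\{a\mid\Box a=a\}$; and $xQ_{\mathfrak B}y$ iff $x\cap H_F\subseteq y$, with $H_F=\{a\mid\blacksquare_F a=a\}$ (equivalently $y\cap H_P\subseteq x$, with $H_P=\{a\mid\blacksquare_P a=a\}$). For a frame $\mathfrak F=(X,R,Q)$ with $R,Q$ quasi-orders on $X$, $\mathfrak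 F^+=(\wp(X),\Box_R,\Box_Q,\Box_{Q^{\smile}})$, where $\Box_R(U)=X\setminus R^{-1}[X\setminus U]$, $\Box_Q(U)=X\setminus Q^{-1}[X\setminus U]$, $\Box_{Q^{\smile}}(U)=X\setminus Q[X\setminus U]$; here $S^{-1}[U]=\{x\mid xSu\text{ for some }u\in U\}$ and $S[U]=\{x\mid uSx\text{ for some }u\in U\}$. *)

(* Defs.v *)
From HB Require Import structures.
From mathcomp Require Import all_boot all_order.
From mathcomp Require Import boolp classical_sets.

Set Implicit Arguments.
Unset Strict Implicit.
Unset Printing Implicit Defensive.

Import Order.Theory.

Local Open Scope classical_set_scope.

(* Boolean algebras are complemented distributive lattices with top and bottom;
   0 = 1 is not excluded.  Powersets [set X] are instances, with the order of
   inclusion, at display [set_display]. *)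

Record modal_algebra (d : Order.disp_t) := ModalAlgebra {
  carrier :> ctbDistrLatticeType d;
  box : carrier -> carrier;
  boxF : carrier -> carrier;
  boxP : carrier -> carrier }.

Record interior_operator (d : Order.disp_t) (B : ctbDistrLatticeType d)
    (i : B -> B) : Prop := InteriorOperator {
  interior_meet : forall a b : B, i (Order.meet a b) = Order.meet (i a) (i b);
  interior_top : i Order.top = Order.top;
  interior_le : forall a : B, (i a <= a)%O;
  interior_idem : forall a : B, (i a <= i (i a))%O }.

Definition dual_op (d : Order.disp_t) (B : ctbDistrLatticeType d)
    (i : B -> B) (a : B) : B :=
  Order.compl (i (Order.compl a)).

Record is_TS4_algebra (d : Order.disp_t) (B : modal_algebra d) : Prop :=
  IsTS4Algebra {
  TS4_box : interior_operator (@box d B);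
  TS4_boxF : interior_operator (@boxF d B);
  TS4_boxP : interior_operator (@boxP d B);
  TS4_PF : forall a : B, (a <= boxP (dual_op (@boxF d B) a))%O;
  TS4_FP : forall a : B, (a <= boxF (dual_op (@boxP d B) a))%O;
  TS4_dia_le : forall a : B,
    (dual_op (@box d B) a <= dual_op (@boxF d B) a)%O;
  TS4_le_dia : forall a : B,
    (dual_op (@boxF d B) a <=
     dual_op (@box d B)
       (Order.meet (dual_op (@boxF d B) a) (dual_op (@boxP d B) a)))%O }.

Record frame := Frame {
  point :> Type;
  frameR : point -> point -> Prop;
  frameQ : point -> point -> Prop;
  frameR_refl : forall x, frameR x x;
  frameR_trans : forall x y z, frameR x y -> frameR y z -> frameR x z;
  frameQ_refl : forall x, frameQ x x;
  frameQ_trans : forall x y z, frameQ x y -> frameQ y z -> frameQ x z }.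

Definition rel_image (X : Type) (S : X -> X -> Prop) (U : set X) : set X :=
  [set x | exists2 u, U u & S u x].

Definition rel_preimage (X : Type) (S : X -> X -> Prop) (U : set X) : set X :=
  [set x | exists2 u, U u & S x u].

Definition complex_algebra (F : frame) : modal_algebra set_display :=
  @ModalAlgebra set_display (set (point F))
    (fun U => ~` rel_preimage (@frameR F) (~` U))
    (fun U => ~` rel_preimage (@frameQ F) (~` U))
    (fun U => ~` rel_image (@frameQ F) (~` U)).

Record proper_filter (d : Order.disp_t) (B : ctbDistrLatticeType d)
    (x : set B) : Prop := ProperFilter {
  filter_top : x Order.top;
  filter_meet : forall a b : B, x a -> x b -> x (Order.meet a b);
  filter_up : forall a b : B, (a <= b)%O -> x a -> x b;
  filter_bot : ~ x Order.bottom }.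

Definition ultrafilter (d : Order.disp_t) (B : ctbDistrLatticeType d)
    (x : set B) : Prop :=
  proper_filter x /\
  forall y : set B, proper_filter y -> x `<=` y -> y = x.

Definition fixpoints (T : Type) (f : T -> T) : set T := [set a | f a = a].

Section CanonicalFrame.
Variables (d : Order.disp_t) (B : modal_algebra d).

Definition ultrafilter_space : Type := {x : set B | ultrafilter x}.

Definition canonical_rel (i : B -> B) (x y : ultrafilter_space) : Prop :=
  sval x `&` fixpoints i `<=` sval y.

Lemma canonical_rel_refl (i : B -> B) (x : ultrafilter_space) :
  canonical_rel i x x.
Proof. by move=> a []. Qed.

Lemma canonical_rel_trans (i : B -> B) (x y z : ultrafilter_space) :
  canonical_rel i x y -> canonical_rel i y z -> canonical_rel i x z.
Proof. by move=> xy yz a [xa ia]; apply: yz; split=> //; apply: xy. Qed.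

Definition canonical_frame : frame :=
  @Frame ultrafilter_space
    (canonical_rel (@box d B)) (canonical_rel (@boxF d B))
    (@canonical_rel_refl (@box d B)) (@canonical_rel_trans (@box d B))
    (@canonical_rel_refl (@boxF d B)) (@canonical_rel_trans (@boxF d B)).

End CanonicalFrame.

(* Main.v *)
Require Import Defs.
From mathcomp Require Import all_boot all_order.
From mathcomp Require Import boolp classical_sets.

(** The defining inequalities of TS4-algebras correspond to conditions on
    frames: a complex algebra is a TS4-algebra as soon as [R] is contained in
    [Q] and every [x Q y] factors as [x R z] with [z] in the same [Q]-cluster
    as [y] ([complex_algebra_TS4]).  So it suffices to check both conditions on
    the canonical frame.

    The inclusion holds because every fixpoint of [boxF] is a fixpoint of
    [box].  For the factorization, let [x Q y] ([canonical_factorization]).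
    The point [z] is any ultrafilter containing the elements [a `&` (b `&` c)]
    where [a] is a [box]-fixpoint in [x], and [b] and [c] are fixpoints of
    [boxF] and [boxP] in [y].  Such an element cannot be [\bot]: as
    [b `&` c] is in [y], its future diamond is in [x], and the last TS4 axiom
    gives that [dia (diaF (b `&` c) `&` diaP (b `&` c))] is in [x]; since
    [boxF] and [boxP] are adjoint to the converse diamonds,
    [diaF (b `&` c) <= c] and [diaP (b `&` c) <= b], so [dia (b `&` c)] is in
    [x].  But [b `&` c <= ~` a] would give
    [dia (b `&` c) <= ~` box a = ~` a]. *)

Set Implicit Arguments.
Unset Strict Implicit.
Unset Printing Implicit Defensive.

Import Order.Theory.

Local Open Scope classical_set_scope.
Local Open Scope order_scope.

(** * Complex algebras of frames *)

Lemma relational_box_interior (X : Type) (S : X -> X -> Prop) :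
    (forall x, S x x) -> (forall x y z, S x y -> S y z -> S x z) ->
  interior_operator (fun U : set X => (~` rel_preimage S (~` U))%classic).
Proof.
move=> S_refl S_trans; split=> [U V||U|U].
- rewrite !meetEset; apply/seteqP; split=> [x nx|x [nU nV] [u nUV Sxu]].
    by split=> -[u nu Sxu]; apply: nx; exists u => // -[].
  apply: nUV; split; apply: contrapT => nu; first by apply: nU; exists u.
  by apply: nV; exists u.
- by apply/seteqP; split=> // x _ [u []].
- rewrite subsetEset => x nx; apply: contrapT => nUx.
  by apply: nx; exists x.
- rewrite subsetEset => x nx [y nny Sxy]; apply: nny => -[z nUz Syz].
  by apply: nx; exists z => //; apply: S_trans Sxy Syz.
Qed.

Lemma complex_algebra_TS4 (F : frame) :
    (forall x y : F, frameR x y -> frameQ x y) ->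
    (forall x y : F, frameQ x y ->
      exists z : F, [/\ frameR x z, frameQ z y & frameQ y z]) ->
  is_TS4_algebra (complex_algebra F).
Proof.
move=> subRQ factQ; split.
- exact: relational_box_interior (@frameR_refl F) (@frameR_trans F).
- exact: relational_box_interior (@frameQ_refl F) (@frameQ_trans F).
- apply: (@relational_box_interior F (fun x y => frameQ y x)).
    exact: frameQ_refl.
  by move=> x y z Qyx Qzy; apply: frameQ_trans Qzy Qyx.
- move=> U; rewrite subsetEset /dual_op !complEset /= => x Ux [u] + Qux.
  by rewrite !setCK; apply; exists x.
- move=> U; rewrite subsetEset /dual_op !complEset /= => x Ux [u] + Qxu.
  by rewrite !setCK; apply; exists x.
- move=> U; rewrite subsetEset /dual_op !complEset /= !setCK => x [u Uu Rxu].
  by exists u => //; apply: subRQ.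
- move=> U; rewrite subsetEset /dual_op !complEset /= !setCK meetEset.
  move=> x [u Uu /factQ [z [Rxz Qzu Quz]]].
  by exists z => //; split; exists u.
Qed.

(** * Ultrafilters *)

Section Ultrafilters.
Variables (d : Order.disp_t) (B : ctbDistrLatticeType d).
Implicit Types (S x y z : set B) (a b : B).

Lemma proper_filter_up_closure S :
    S !=set0 -> (forall a b, S a -> S b -> S (a `&` b)) -> ~ S \bot ->
  proper_filter [set a | exists2 b, S b & b <= a].
Proof.
move=> [s Ss] SI S0; split.
- by exists s; rewrite ?lex1.
- move=> a b [a' Sa' le_a] [b' Sb' le_b]; exists (a' `&` b'); first exact: SI.
  exact: leI2.
- by move=> a b le_ab [a' Sa' le_a]; exists a' => //; apply: le_trans le_ab.
- by move=> [a Sa]; rewrite lex0 => /eqP a0; apply: S0; rewrite -a0.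
Qed.

(** Every proper filter extends to an ultrafilter.  Zorn's lemma is applied to
    the sets whose union with [x] is a proper filter: the empty set is one of
    them, so the empty chain is not an exception. *)
Lemma proper_filter_sub_ultrafilter x :
  proper_filter x -> exists2 z, ultrafilter z & (x `<=` z)%classic.
Proof.
move=> pf_x.
pose P := [set y : set B | proper_filter (y `|` x)%classic].
have [F FP Ftot|y [Py maxy]] := @Zorn_bigcup _ P.
  split.
  - by right; apply: filter_top.
  (* Unless both are in [x], two elements of the union lie in [y `|` x] for a
     common [y] in the chain [F]. *)
  - suff common a b : (\bigcup_(y in F) y `|` x)%classic a ->
        (\bigcup_(y in F) y `|` x)%classic b ->
        (x a /\ x b) \/
        exists2 y, F y & (y `|` x)%classic a /\ (y `|` x)%classic b.
      move=> a b Ua Ub; have [[xa xb]|[y Fy [ya yb]]] := common a b Ua Ub.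
        by right; apply: filter_meet.
      have [yI|xI] := filter_meet (FP _ Fy) ya yb; last by right.
      by left; exists y.
    move=> [[y Fy ya]|xa] [[z Fz zb]|xb].
    + right; have [yz|zy] := Ftot _ _ Fy Fz.
        by exists z => //; split; left => //; apply: yz.
      by exists y => //; split; left => //; apply: zy.
    + by right; exists y => //; split; [left|right].
    + by right; exists z => //; split; [right|left].
    + by left.
  - move=> a b le_ab [[y Fy ya]|xa].
      have [yb|xb] := filter_up (FP _ Fy) le_ab (or_introl ya); last by right.
      by left; exists y.
    by right; apply: filter_up xa.
  - move=> [[y Fy y0]|x0]; last exact: filter_bot x0.
    by apply: (filter_bot (FP _ Fy)); left.
exists (y `|` x)%classic; last by move=> a xa; right.
split=> // w pf_w sub_w.
have wy : w = y.
  apply: contrapT => ne_wy; apply: (maxy w).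
    split=> [a ya|sub_wy]; first by apply: sub_w; left.
    by apply: ne_wy; apply/seteqP; split=> // a ya; apply: sub_w; left.
  rewrite /P /=; suff -> : (w `|` x)%classic = w by [].
  by apply/setUidPl => a xa; apply: sub_w; right.
by apply/seteqP; split=> // a wa; left; rewrite -wy.
Qed.

Lemma ultrafilter_exists S :
    S !=set0 -> (forall a b, S a -> S b -> S (a `&` b)) -> ~ S \bot ->
  exists2 z, ultrafilter z & (S `<=` z)%classic.
Proof.
move=> S_ne SI S0.
have [z uf_z sub_z] :=
  proper_filter_sub_ultrafilter (proper_filter_up_closure S_ne SI S0).
by exists z => // a Sa; apply: sub_z; exists a.
Qed.

(** If [a] is not in [x], then [x] and [~` a] generate a proper filter, which
    equals [x] by maximality. *)
Lemma ultrafilter_compl x a : ultrafilter x -> ~ x a -> x (~` a).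
Proof.
move=> [pf_x max_x] nxa.
pose S := [set b `&` ~` a | b in x].
have pf_S : proper_filter [set c | exists2 b, S b & b <= c].
  apply: proper_filter_up_closure.
  - by exists (\top `&` ~` a); exists \top => //; apply: filter_top.
  - move=> _ _ [b xb <-] [c xc <-]; exists (b `&` c); first exact: filter_meet.
    by rewrite meetACA meetxx.
  - move=> [b xb /eqP]; rewrite disj_leC complK => le_ba.
    by apply: nxa; apply: filter_up le_ba xb.
rewrite -(max_x _ pf_S) => [|b xb].
  exists (\top `&` ~` a); last by rewrite meet1x.
  by exists \top => //; apply: filter_top.
by exists (b `&` ~` a); [exists b | apply: leIl].
Qed.

Lemma ultrafilter_not_compl x a : ultrafilter x -> x a -> ~ x (~` a).
Proof.
move=> [pf_x _] xa xCa; apply: (filter_bot pf_x).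
by rewrite -(meetxC a); apply: filter_meet.
Qed.

End Ultrafilters.

(** * Interior operators *)

Section Interior.
Variables (d : Order.disp_t) (B : ctbDistrLatticeType d) (i : B -> B).
Hypothesis int_i : interior_operator i.
Implicit Types a b : B.

Lemma interior_mono a b : a <= b -> i a <= i b.
Proof. by move=> /meet_idPl ab; rewrite -ab (interior_meet int_i) leIr. Qed.

Lemma fixpoints_interior a : fixpoints i (i a).
Proof.
by apply/eqP; rewrite eq_le (interior_le int_i) (interior_idem int_i).
Qed.

Lemma fixpoints_meet a b :
  fixpoints i a -> fixpoints i b -> fixpoints i (a `&` b).
Proof. by move=> ia ib; rewrite /fixpoints /= (interior_meet int_i) ia ib. Qed.

Lemma dual_op_mono a b : a <= b -> dual_op i a <= dual_op i b.
Proof. by move=> ab; rewrite /dual_op leC interior_mono // leC. Qed.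

End Interior.

(** * The canonical frame *)

Section Canonical.
Variables (d : Order.disp_t) (B : modal_algebra d).
Hypothesis hB : is_TS4_algebra B.
Implicit Types (x y z : ultrafilter_space B) (a b c : B).

Let box_int := TS4_box hB.
Let boxF_int := TS4_boxF hB.
Let boxP_int := TS4_boxP hB.

Lemma fixpoints_boxF_box a : fixpoints (@boxF d B) a -> fixpoints (@box d B) a.
Proof.
move=> Fa; apply/eqP; rewrite eq_le (interior_le box_int) /=.
by have := TS4_dia_le hB (~` a); rewrite /dual_op leC complK Fa.
Qed.

Lemma dual_boxP_fixF b : fixpoints (@boxF d B) b -> dual_op (@boxP d B) b <= b.
Proof.
move=> Fb; rewrite /dual_op leCx -{2}Fb.
by have := TS4_PF hB (~` b); rewrite /dual_op complK.
Qed.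

Lemma dual_boxF_fixP c : fixpoints (@boxP d B) c -> dual_op (@boxF d B) c <= c.
Proof.
move=> Pc; rewrite /dual_op leCx -{2}Pc.
by have := TS4_FP hB (~` c); rewrite /dual_op complK.
Qed.

Lemma fixpoints_boxP_compl a :
  fixpoints (@boxF d B) a -> fixpoints (@boxP d B) (~` a).
Proof.
move=> Fa; apply/eqP; rewrite eq_le (interior_le boxP_int) /=.
by have := dual_boxP_fixF Fa; rewrite /dual_op leCx.
Qed.

(** The relation [Q] of the canonical frame can be tested on the past
    fixpoints instead of the future ones. *)
Lemma canonical_rel_past y z :
    (sval y `&` fixpoints (@boxP d B) `<=` sval z)%classic ->
  canonical_rel (@boxF d B) z y.
Proof.
move=> sub_yz a [za Fa]; apply: contrapT => nya.
apply: (ultrafilter_not_compl (svalP z) za); apply: sub_yz; split.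
  exact: ultrafilter_compl (svalP y) nya.
exact: fixpoints_boxP_compl.
Qed.

Lemma canonical_rel_dual_op (i : B -> B) x y a :
    interior_operator i -> canonical_rel i x y -> sval y a ->
  sval x (dual_op i a).
Proof.
move=> int_i xy ya; apply: (ultrafilter_compl (svalP x)) => xiCa.
have yiCa : sval y (i (~` a)) by apply: xy; split; [|apply: fixpoints_interior].
apply: (ultrafilter_not_compl (svalP y) ya).
exact: filter_up (proj1 (svalP y)) _ _ (interior_le int_i _) yiCa.
Qed.

Lemma canonical_factorization x y :
    canonical_rel (@boxF d B) x y ->
  exists z, [/\ canonical_rel (@box d B) x z,
    canonical_rel (@boxF d B) z y & canonical_rel (@boxF d B) y z].
Proof.
move=> xQy; have [pf_x _] := svalP x; have [pf_y _] := svalP y.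
pose S : set B := [set e | exists a b c,
  [/\ (sval x `&` fixpoints (@box d B))%classic a,
      (sval y `&` fixpoints (@boxF d B))%classic b,
      (sval y `&` fixpoints (@boxP d B))%classic c & e = a `&` (b `&` c)]].
have topx : (sval x `&` fixpoints (@box d B))%classic \top.
  by split; [apply: filter_top | apply: interior_top box_int].
have topF : (sval y `&` fixpoints (@boxF d B))%classic \top.
  by split; [apply: filter_top | apply: interior_top boxF_int].
have topP : (sval y `&` fixpoints (@boxP d B))%classic \top.
  by split; [apply: filter_top | apply: interior_top boxP_int].
have [|||z uf_z sub_z] := @ultrafilter_exists _ _ S.
- by exists (\top `&` (\top `&` \top)); exists \top, \top, \top.
- move=> e e' [a [b [c [[xa Ha] [yb Fb] [yc Pc] ->]]]].
  move=> [a' [b' [c' [[xa' Ha'] [yb' Fb'] [yc' Pc'] ->]]]].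
  exists (a `&` a'), (b `&` b'), (c `&` c'); split.
  + by split; [apply: filter_meet | apply: fixpoints_meet].
  + by split; [apply: filter_meet | apply: fixpoints_meet].
  + by split; [apply: filter_meet | apply: fixpoints_meet].
  + by rewrite meetACA (meetACA b).
- move=> [a [b [c [[xa Ha] [yb Fb] [yc Pc] /esym/eqP abc0]]]].
  have le_bc : b `&` c <= ~` a by rewrite lexC -disj_leC.
  have ybc : sval y (b `&` c) by apply: filter_meet.
  have le_dual : dual_op (@boxF d B) (b `&` c) `&` dual_op (@boxP d B) (b `&` c)
      <= b `&` c.
    rewrite meetC; apply: leI2.
      exact: le_trans (dual_op_mono boxP_int (leIl _ _)) (dual_boxP_fixF Fb).
    exact: le_trans (dual_op_mono boxF_int (leIr _ _)) (dual_boxF_fixP Pc).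
  have := canonical_rel_dual_op boxF_int xQy ybc.
  move=> /(filter_up pf_x (TS4_le_dia hB _)).
  move=> /(filter_up pf_x (dual_op_mono box_int (le_trans le_dual le_bc))).
  by rewrite /dual_op complK Ha; apply: ultrafilter_not_compl (svalP x) xa.
exists (exist _ z uf_z); split.
- by move=> a Ha; apply: sub_z; exists a, \top, \top; rewrite !meetx1.
- apply: canonical_rel_past => c Pc; apply: sub_z.
  by exists \top, \top, c; rewrite !meet1x.
- by move=> b Fb; apply: sub_z; exists \top, b, \top; rewrite meet1x meetx1.
Qed.

End Canonical.

Theorem corollary3p21 (d : Order.disp_t) (B : modal_algebra d)
    (hB : is_TS4_algebra B) :
  is_TS4_algebra (complex_algebra (canonical_frame B)).
Proof.
apply: complex_algebra_TS4 => [x y xRy a [xa Fa]|x y].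
  by apply: xRy; split=> //; apply: fixpoints_boxF_box.
exact: canonical_factorization.
Qed.
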